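(* Let $(g_i)_{i=1}^\infty$ be a frame for $\mathcal{H}$ and let the kernel of its synthesis operator $T:\ell^2\to\mathcal{H}$, $T(c_i)_{i=1}^\infty=\sum_{i=1}^\infty c_ig_i$, be finite-dimensional. For a sequence $(f_i)_{i=1}^\infty$ with elements from $\mathcal{H}$, the following statements are equivalent. (i) $(f_i)_{i=1}^\infty$ is an s-pseudo-dual of $(g_i)_{i=1}^\infty$. (ii) $(f_i)_{i=1}^\infty$ is an a-pseudo-dual of $(g_i)_{i=1}^\infty$. (iii) $(f_i)_{i=1}^\infty$ is a dual frame of $(g_i)_{i=1}^\infty$.
   Context: $\mathcal{H}$ is an infinite-dimensional separable Hilbert space. All series converge in norm. A sequence $(g_i)_{i=1}^\infty$ in $\mathcal{H}$ is a frame for $\mathcal{H}$ if there are $A,B>0$ with $A\|h\|^2\le\sum_{i=1}^\infty|\langle h,g_i\rangle|^2\le B\|h\|^2$ for all $h\in\mathcal{H}$. Given a frame $(g_i)$ for $\mathcal{H}$, a sequence $(f_i)_{i=1}^\infty$ in $\mathcal{H}$ is - an s-pseudo-dual (synthesis-pseudo-dual) of $(g_i)$ if $f=\sum_{i=1}^\infty\langle f,g_i\rangle f_i$ for all $f\in\mathcal{H}$; - an a-pseudo-dual (analysis-pseudo-dual) of $(g_i)$ if $g=\sum_{i=1}^\infty\langle g,f_i\rangle g_i$ for all $g\in\mathcal{H}$; - a dual frame of $(g_i)$ if $(f_i)$ is a frame for $\mathcal{H}$ satisfying both $f=\sum_{i=1}^\infty\langle f,g_i\rangle f_i$ for all $f\in\mathcal{H}$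 and $g=\sum_{i=1}^\infty\langle g,f_i\rangle g_i$ for all $g\in\mathcal{H}$. *)

(* Defs.v *)
From mathcomp Require Import all_boot all_order all_algebra.
From mathcomp Require Import complex.
From mathcomp Require Import all_classical all_reals all_analysis.

Set Implicit Arguments.
Unset Strict Implicit.
Unset Printing Implicit Defensive.

Import Order.TTheory GRing.Theory Num.Theory.
Import numFieldNormedType.Exports.

Local Open Scope classical_set_scope.
Local Open Scope ring_scope.

(* Hilbert spaces are either real or complex, so the scalar field is R or R[i]. *)
Variant scalar_kind := real_scalars | complex_scalars.

Definition hscalar (R : realType) (k : scalar_kind) : numFieldType :=
  match k with
  | real_scalars => R
  | complex_scalars => R[i]%C
  end.

Definition hscalar_conj (R : realType) (k : scalar_kind) :
    hscalar R k -> hscalar R k :=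
  match k with
  | real_scalars => idfun
  | complex_scalars => @conjc R
  end.

Definition separable (T : topologicalType) : Prop :=
  exists2 D : set T, countable D & dense D.

(* Meant for sets S that are linear subspaces of V. *)
Definition finite_dimensional (K : numFieldType) (V : lmodType K)
    (S : set V) : Prop :=
  exists (n : nat) (e : 'I_n -> V),
    (forall i, S (e i)) /\
    (forall x, S x -> exists c : 'I_n -> K, x = \sum_(i < n) c i *: e i).

Definition ell2 (K : numFieldType) : set (nat -> K) :=
  [set c : nat -> K | cvgn (series (fun i => `|c i| ^+ 2 : K))].

Section frames.
Context (K : numFieldType) (H : normedModType K) (ip : H -> H -> K).

(* Over R[i], the order is x <= y iff y - x is a nonnegative real, so the bounds
   A, B and the sums compared with them are real in the complex case as well. *)
Definition is_frame (g : nat -> H) : Prop :=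
  exists A B : K, [/\ 0 < A, 0 < B &
    forall h : H, let s := series (fun i => `|ip h (g i)| ^+ 2) in
      cvgn s /\ A * `|h| ^+ 2 <= limn s <= B * `|h| ^+ 2].

Definition s_pseudo_dual (g f : nat -> H) : Prop :=
  forall h : H, series (fun i => ip h (g i) *: f i) @ \oo --> h.

Definition a_pseudo_dual (g f : nat -> H) : Prop :=
  forall h : H, series (fun i => ip h (f i) *: g i) @ \oo --> h.

Definition dual_frame (g f : nat -> H) : Prop :=
  [/\ is_frame f, s_pseudo_dual g f & a_pseudo_dual g f].

(* limn is a default value on divergent series; for g a frame, the series
   converges for every c in ell2. *)
Definition synthesis (g : nat -> H) (c : nat -> K) : H :=
  limn (series (fun i => c i *: g i)).

(* K^o is K as a module over itself, which makes sequences an lmodType. *)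
Definition synthesis_ker (g : nat -> H) : set (nat -> K^o) :=
  [set c : nat -> K^o | ell2 c /\ synthesis g c = 0].

End frames.

(* Main.v *)
Require Import Defs.
From mathcomp Require Import all_boot all_order all_algebra.
From mathcomp Require Import complex sesquilinear.
From mathcomp Require Import all_classical all_reals all_analysis.
From mathcomp Require Import ring lra.

(** Write [V h n] for the partial sum of [<h, g_i> f_i] over [i < n], and [W h n]
    for the one of [<h, f_i> g_i]. The operators [V _ n] and [W _ n] are adjoint
    to each other, and (i), (ii) say that the first, resp. the second, converges
    strongly to the identity. The heart of the matter is that either of them
    forces [f] to be a Bessel sequence; the rest holds for any two Bessel
    sequences.

    Suppose (i) or (ii). A strongly convergent sequence of bounded operators is
    uniformly bounded ([uniform_boundedness]), and passing to adjoints preserves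
    the bound ([adjoint_uniformly_bounded]), so in both cases
    [|W h n| <= M |h|] for all [h] and [n]. Since the synthesis operator of [g]
    has a finite-dimensional kernel, dropping finitely many elements of [g]
    leaves a sequence with a lower Riesz bound ([tail_riesz_bound]): the l2 norm
    of the coefficients is controlled by the norm of the sum. Applied to the
    coefficients [<h, f_i>] with [N <= i < n], it bounds their sum of squares by
    a multiple of [|h| ^ 2], uniformly in [n]; the first [N] coefficients are
    harmless, so [f] is Bessel ([bounded_mixed_bessel]).

    For the lower Riesz bound, a kernel vector is determined by finitely many of
    its coordinates, because the kernel is finite-dimensional: for some [N] its
    l2 norm is at most a constant times that of its first [N] coordinates
    ([kernel_head_bound]). Let [c] be supported in [N, n) and let [x] be its
    synthesis. The frame operator of [g] is onto
    ([frame_operator_surjective]), so [x] is also the synthesis of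
    [(<h, g_i>)_i] for some [h], with norm at most a multiple of [|x|]
    ([frame_operator_lower]). The difference of the two coefficient sequences is
    in the kernel and its first [N] coordinates are the [- <h, g_i>]; hence it is
    controlled by [|x|], and so is [c].

    Once [f] and [g] are Bessel, [W h n] converges to some [x] whenever (i) holds,
    and [x = h] because [<W h n, y> = <h, V y n>] tends to [<h, y>]
    ([s_pseudo_dual_sym]). As (ii) is (i) with [f] and [g] exchanged, this gives
    both implications between them. The lower frame bound of [f] comes from
    [|h| ^ 2 = lim <V h n, h>] and the Bessel bound of [g]
    ([dual_frame_bounds]). *)

Set Implicit Arguments.
Unset Strict Implicit.
Unset Printing Implicit Defensive.

Import Order.TTheory GRing.Theory Num.Theory.
Import numFieldNormedType.Exports.

Local Open Scope classical_set_scope.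
Local Open Scope ring_scope.

(** * Scalars over the real numbers *)

(** The real and the complex scalars are treated together. Norms over the
    complex field take values in a field that is only partially ordered; the
    modulus [mod], with values in [R], brings every estimate back to the reals. *)
Record real_scaled (R : realType) (K : numFieldType) (cj : K -> K) := {
  emb : {rmorphism R -> K};
  mod : K -> R;
  ler_emb : forall r s, (emb r <= emb s) = (r <= s);
  emb_mod : forall a, emb (mod a) = `|a|;
  conj_emb : forall r, cj (emb r) = emb r;
  mul_conj : forall a, a * cj a = `|a| ^+ 2
}.

Lemma hscalar_real_scaled (R : realType) (k : scalar_kind) :
  real_scaled R (@hscalar_conj R k).
Proof.
case: k; rewrite /hscalar /hscalar_conj.
  exists idfun (fun a => `|a|) => // a.
  by rewrite -normrX ger0_norm ?sqr_ge0 // expr2.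
exists (real_complex R) (fun a => complex.Re `|a|) => [r s|a|r|a].
- exact: lecR.
- by rewrite normc_def.
- exact: conjc_real.
- by rewrite sqr_normc.
Qed.

Lemma sum_window (V : nmodType) (v : nat -> V) N n m : (N <= n)%N -> (n <= m)%N ->
  \sum_(0 <= i < m) (if (N <= i < n)%N then v i else 0) = \sum_(N <= i < n) v i.
Proof.
move=> Nn nm; rewrite (big_cat_nat (n := N)) ?(leq_trans Nn) //=.
rewrite big_nat_cond big1 ?add0r => [|i]; last first.
  by rewrite andbT => /andP[_ iN]; rewrite leqNgt iN.
rewrite (big_cat_nat (n := n)) //= [X in _ + X]big_nat_cond [X in _ + X]big1.
  by rewrite addr0; apply: eq_big_nat => i ->.
by move=> i; rewrite andbT => /andP[ni _]; rewrite ltnNge ni andbF.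
Qed.

Section Hilbert.
Context {R : realType} {K : numFieldType} {cj : K -> K}.
Context (sc : real_scaled R cj) {H : completeNormedModType K}.
Context (ip : {dot H for cj}) (ip_norm : forall x : H, `|x| ^+ 2 = ip x x).
Local Notation emb := (emb sc).
Local Notation mod := (mod sc).
Local Notation ler_emb := (ler_emb sc).
Local Notation emb_mod := (emb_mod sc).
Implicit Types (r s : R) (a b : K) (x y z h : H) (u : nat -> H) (m n : nat).

(** * Moduli and norms as real numbers *)

Lemma emb0 : emb 0 = 0 :> K. Proof. exact: rmorph0. Qed.

Lemma ltr_emb r s : (emb r < emb s :> K) = (r < s).
Proof. by rewrite !lt_def !ler_emb fmorph_eq. Qed.

Lemma emb_inj : injective emb.
Proof. exact: fmorph_inj. Qed.

Lemma mod_ge0 a : 0 <= mod a.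
Proof. by rewrite -ler_emb emb0 emb_mod. Qed.

Lemma modD a b : mod (a + b) <= mod a + mod b.
Proof. by rewrite -ler_emb rmorphD /= !emb_mod ler_normD. Qed.

Lemma modN a : mod (- a) = mod a.
Proof. by apply: emb_inj; rewrite !emb_mod normrN. Qed.

Lemma modM a b : mod (a * b) = mod a * mod b.
Proof. by apply: emb_inj; rewrite rmorphM /= !emb_mod normrM. Qed.

Lemma norm_emb r : `|emb r| = emb `|r|.
Proof.
case: (lerP 0 r) => r0; first by rewrite !ger0_norm // -emb0 ler_emb.
by rewrite !ltr0_norm ?rmorphN // -emb0 ltr_emb.
Qed.

Lemma mod_emb r : mod (emb r : K) = `|r|.
Proof. by apply: emb_inj; rewrite emb_mod norm_emb. Qed.

Lemma mod_norm a : mod `|a| = mod a.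
Proof. by apply: emb_inj; rewrite !emb_mod normr_id. Qed.

Lemma mod0 : mod (0 : K) = 0.
Proof. by rewrite -emb0 mod_emb normr0. Qed.

Lemma mod_sum I (s : seq I) (P : pred I) (F : I -> K) :
  mod (\sum_(i <- s | P i) F i) <= \sum_(i <- s | P i) mod (F i).
Proof.
elim/big_rec2 : _ => [|i r a _ le_ar]; first by rewrite mod0.
by rewrite (le_trans (modD _ _)) // lerD2l.
Qed.

Lemma emb_gt0_norm a : 0 < a -> a = emb (mod a).
Proof. by move=> /gtr0_norm {1}<-; rewrite emb_mod. Qed.

Lemma cvg_emb (u : nat -> R) l :
  u @ \oo --> l -> (fun n => emb (u n) : K) @ \oo --> (emb l : K).
Proof.
move=> /cvgrPdist_lt ul; apply/cvgrPdist_lt => e e0.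
have eE := emb_gt0_norm e0.
have me0 : 0 < mod e by rewrite -ltr_emb emb0 -eE.
near=> n; rewrite -rmorphB norm_emb eE ltr_emb.
by near: n; exact: ul.
Unshelve. all: by end_near. Qed.

Definition nrm x : R := mod `|x|.

Lemma emb_nrm x : emb (nrm x) = `|x|.
Proof. by rewrite emb_mod normr_id. Qed.

Lemma nrm_ge0 x : 0 <= nrm x. Proof. exact: mod_ge0. Qed.

Lemma nrm0 : nrm 0 = 0. Proof. by rewrite /nrm normr0 mod0. Qed.

Lemma nrm0_eq0 x : nrm x = 0 -> x = 0.
Proof. by move=> x0; apply/eqP; rewrite -normr_eq0 -emb_nrm x0 emb0. Qed.

Lemma nrmD x y : nrm (x + y) <= nrm x + nrm y.
Proof. by rewrite -ler_emb rmorphD /= !emb_nrm ler_normD. Qed.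

Lemma nrmN x : nrm (- x) = nrm x.
Proof. by rewrite /nrm normrN. Qed.

Lemma nrm_dist x y : nrm (x - y) = nrm (y - x).
Proof. by rewrite -nrmN opprB. Qed.

Lemma nrmZ a x : nrm (a *: x) = mod a * nrm x.
Proof. by rewrite /nrm normrZ modM mod_norm. Qed.

Lemma nrm_sum I (s : seq I) (P : pred I) (F : I -> H) :
  nrm (\sum_(i <- s | P i) F i) <= \sum_(i <- s | P i) nrm (F i).
Proof.
elim/big_rec2 : _ => [|i x y _ le_xy]; first by rewrite nrm0.
by rewrite (le_trans (nrmD _ _)) // lerD2l.
Qed.

Lemma cvg_nrmP (u : nat -> H) x :
  u @ \oo --> x <-> (fun n => nrm (x - u n)) @ \oo --> (0 : R).
Proof.
split=> [/cvgrPdist_lt ux|/cvgrPdist_lt ux]; apply/cvgrPdist_lt => e e0.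
  near=> n; rewrite sub0r normrN ger0_norm ?nrm_ge0 // -ltr_emb emb_nrm.
  by near: n; apply: ux; rewrite -emb0 ltr_emb.
have eE := emb_gt0_norm e0.
have me0 : 0 < mod e by rewrite -ltr_emb emb0 -eE.
near=> n; rewrite -emb_nrm eE ltr_emb.
have : `|0 - nrm (x - u n)| < mod e by near: n; exact: ux.
by rewrite sub0r normrN ger0_norm ?nrm_ge0.
Unshelve. all: by end_near. Qed.

Lemma cvg_nrm (u : nat -> H) x :
  u @ \oo --> x -> (fun n => nrm (u n)) @ \oo --> nrm x.
Proof.
move=> /cvg_nrmP/cvgrPdist_lt ux; apply/cvgrPdist_lt => e e0.
near=> n.
have : `|0 - nrm (x - u n)| < e by near: n; exact: ux.
rewrite sub0r normrN ger0_norm ?nrm_ge0 //; apply: le_lt_trans.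
rewrite ler_norml; apply/andP; split.
  by have := nrmD (u n - x) x; rewrite subrK nrm_dist; lra.
by have := nrmD (x - u n) (u n); rewrite subrK; lra.
Unshelve. all: by end_near. Qed.

(** Every completeness argument below goes through this form of the Cauchy
    criterion, which also gives the rate of convergence. *)
Lemma cvg_tail_bound (u : nat -> H) (rho : nat -> R) :
  rho @ \oo --> (0 : R) ->
  (forall m n, (m <= n)%N -> nrm (u n - u m) <= rho m) ->
  exists2 x, u @ \oo --> x & forall m, nrm (x - u m) <= rho m.
Proof.
move=> rho0 u_rho.
have u_cvg : cvgn u.
  apply/cauchy_cvgP/cauchy_ballP => e e0.
  have eE := emb_gt0_norm e0.
  have me0 : 0 < mod e by rewrite -ltr_emb emb0 -eE.
  have [N _ rhoN] : \forall N \near \oo, rho N < mod e.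
    exact: cvgr_lt rho0 _ me0.
  exists (u @` [set n | (N <= n)%N], u @` [set n | (N <= n)%N]).
    by split; exists N => // n Nn; exists n.
  move=> [_ _] [[m /= Nm <-] [n /= Nn <-]].
  rewrite -ball_normE /= -emb_nrm eE ltr_emb.
  wlog mn : m n Nm Nn / (m <= n)%N => [hw|].
    by case/orP: (leq_total m n) => ?; [|rewrite nrm_dist]; exact: hw.
  by rewrite nrm_dist; apply: le_lt_trans (u_rho _ _ mn) _; exact: rhoN.
exists (limn u) => // m.
have ux : (fun n => nrm (u n - u m)) @ \oo --> nrm (limn u - u m).
  by apply: cvg_nrm; apply: cvgB => //; exact: cvg_cst.
apply: (cvgr_to_le ux); near=> n; apply: u_rho.
by near: n; exact: nbhs_infty_ge.
Unshelve. all: by end_near. Qed.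



(** * The inner product *)

Lemma ipDl x y z : ip (x + y) z = ip x z + ip y z. Proof. exact: linearDl. Qed.
Lemma ipBl x y z : ip (x - y) z = ip x z - ip y z. Proof. exact: linearBl. Qed.
Lemma ipBr x y z : ip z (x - y) = ip z x - ip z y. Proof. exact: linearBr. Qed.
Lemma ipZl a x y : ip (a *: x) y = a * ip x y. Proof. exact: linearZl_LR. Qed.
Lemma ipZr a x y : ip x (a *: y) = cj a * ip x y.
Proof. exact: linearZr_LR. Qed.
Lemma ip_suml I (s : seq I) (P : pred I) (F : I -> H) y :
  ip (\sum_(i <- s | P i) F i) y = \sum_(i <- s | P i) ip (F i) y.
Proof. exact: linear_sumlz. Qed.
Lemma ip_sumr I (s : seq I) (P : pred I) (F : I -> H) y :
  ip y (\sum_(i <- s | P i) F i) = \sum_(i <- s | P i) ip y (F i).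
Proof. exact: linear_sumr. Qed.
Lemma ipC x y : ip y x = cj (ip x y).
Proof. by have := hermitian_subproof (s := ip) y x; rewrite expr0 mul1r. Qed.
Lemma ip_nrm x : ip x x = emb (nrm x ^+ 2).
Proof. by rewrite -ip_norm -emb_nrm rmorphXn. Qed.

Lemma mul_conj_mod a : a * cj a = emb (mod a ^+ 2).
Proof. by rewrite (mul_conj sc) rmorphXn /= emb_mod. Qed.

Lemma mod_conj a : mod (cj a) = mod a.
Proof.
have [->|a0] := eqVneq a 0; first by rewrite -emb0 (conj_emb sc).
have ma0 : mod a != 0 by rewrite -(fmorph_eq0 emb) emb_mod normr_eq0.
apply: (mulfI ma0); rewrite -modM mul_conj_mod mod_emb ger0_norm ?sqr_ge0 //.
Qed.

(** The square of the norm of [|y| ^ 2 x - <x, y> y] is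
    [|y| ^ 2 (|y| ^ 2 |x| ^ 2 - |<x, y>| ^ 2)]. *)
Lemma cauchy_schwarz x y : mod (ip x y) <= nrm x * nrm y.
Proof.
have [y0|y_neq0] := eqVneq (nrm y) 0.
  by rewrite (nrm0_eq0 y0) nrm0 mulr0 linear0r mod0.
have y_gt0 : 0 < nrm y by rewrite lt_neqAle eq_sym y_neq0 nrm_ge0.
set b := nrm y ^+ 2; have b_gt0 : 0 < b by rewrite exprn_gt0.
have : 0 <= b * (b * nrm x ^+ 2 - mod (ip x y) ^+ 2).
  rewrite (_ : b * _ = nrm (emb b *: x - ip x y *: y) ^+ 2) ?sqr_ge0 //.
  apply: emb_inj; rewrite -ip_nrm ipBl !ipBr !ipZl !ipZr !ip_nrm -/b.
  rewrite (ipC x y) (conj_emb sc) (rmorphM emb) rmorphB /=.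
  by rewrite -(mul_conj_mod (ip x y)) (rmorphM emb b) /=; ring.
rewrite pmulr_rge0 // subr_ge0 /b -exprMn => le_sq.
rewrite -(@ler_pXn2r _ 2) ?nnegrE ?mod_ge0 ?mulr_ge0 ?nrm_ge0 //.
by rewrite [X in _ <= X ^+ 2]mulrC.
Qed.

(** * The uniform boundedness principle *)

(** Gliding hump. If the [T n] are not uniformly bounded, then any closed ball,
    with centre [x], contains a point [x + y] or [x - y] at which some [T n] is
    large, because [T n (x + y) - T n (x - y) = 2 T n y]; as [T n] is continuous,
    it stays large on a smaller ball around that point. The common point of a
    nested sequence of such balls violates pointwise boundedness. *)
Lemma uniform_boundedness (T : nat -> H -> H) :
  (forall n a x y, T n (a *: x + y) = a *: T n x + T n y) ->
  (forall n, exists C, forall x, nrm (T n x) <= C * nrm x) ->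
  (forall x, exists M, forall n, nrm (T n x) <= M) ->
  exists2 M, 0 <= M & forall n x, nrm (T n x) <= M * nrm x.
Proof.
move=> Tlin Tbdd Tptw; apply: contrapT => unbounded.
have T0 n : T n 0 = 0.
  by have := Tlin n (-1) 0 0; rewrite scaler0 add0r scaleN1r addNr.
have Tadd n x y : T n (x + y) = T n x + T n y.
  by have := Tlin n 1 x y; rewrite !scale1r.
have TZ n a x : T n (a *: x) = a *: T n x.
  by have := Tlin n a x 0; rewrite T0 !addr0.
have TB n x y : T n (x - y) = T n x - T n y.
  by rewrite Tadd -[- y]scaleN1r TZ scaleN1r.
have escape M : 0 <= M -> exists n y, M * nrm y < nrm (T n y).
  move=> M0; apply: contrapT => noesc; apply: unbounded; exists M => // n y.
  by rewrite leNgt; apply/negP => lt; apply: noesc; exists n, y.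
have step (q : H * R) (L : nat) : exists q' : H * R,
    0 < q.2 -> [/\ 0 < q'.2, q'.2 <= q.2 / 2,
      nrm (q'.1 - q.1) + q'.2 <= q.2 &
      exists n, forall z, nrm (z - q'.1) <= q'.2 -> L%:R <= nrm (T n z)].
  case: q => x r /=; have [r_gt0|_] := ltP 0 r; last by exists (x, r).
  (* [M] is such that vectors [y] of norm [r / 2] with [M |y| < |T n y|] satisfy
     [L + 1 < |T n y|]; the extra 1 is lost when passing from the centre of the
     new ball to its other points. *)
  pose M : R := 2 * (L%:R + 1) / r.
  have M_gt0 : 0 < M by rewrite !mulr_gt0 ?invr_gt0 // addr_ge0_gt0.
  have [n [y yM]] := escape M (ltW M_gt0).
  have [C TC] := Tbdd n.
  have y_gt0 : 0 < nrm y.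
    rewrite lt_neqAle eq_sym nrm_ge0 andbT; apply/eqP => y0.
    by move: yM; rewrite (nrm0_eq0 y0) T0 !nrm0 mulr0 ltxx.
  pose t := r / 2 / nrm y.
  have t_gt0 : 0 < t by rewrite !mulr_gt0 ?invr_gt0.
  have nrm_ty : nrm (emb t *: y) = r / 2.
    by rewrite nrmZ mod_emb gtr0_norm // /t divfK // gt_eqF.
  have T_ty : L%:R + 1 < nrm (T n (emb t *: y)).
    rewrite TZ nrmZ mod_emb gtr0_norm //.
    rewrite (_ : L%:R + 1 = t * (M * nrm y)) ?ltr_pM2l // /t /M.
    by field; rewrite !gt_eqF.
  have [x' x'x Tx'] : exists2 x', nrm (x' - x) = r / 2 & L%:R + 1 < nrm (T n x').
    have : L%:R + 1 < nrm (T n (x + emb t *: y)) \/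
           L%:R + 1 < nrm (T n (x - emb t *: y)).
      apply: contrapT => /not_orP[/negP]; rewrite -leNgt => le1 /negP.
      rewrite -leNgt => le2; move: T_ty; apply/negP; rewrite -leNgt.
      have : nrm (T n (emb t *: y) + T n (emb t *: y)) <=
             (L%:R + 1) + (L%:R + 1).
        have -> : T n (emb t *: y) + T n (emb t *: y) =
            T n (x + emb t *: y) - T n (x - emb t *: y).
          by rewrite Tadd TB opprB [T n x + _]addrC -addrA [T n x + _]addrCA
            subrr addr0.
        by apply: le_trans (nrmD _ _) _; rewrite nrmN lerD.
      rewrite -mulr2n -scaler_nat nrmZ -(rmorph_nat emb) mod_emb ger0_norm //.
      lra.
    case=> lt; first by exists (x + emb t *: y) => //; rewrite addrC addKr.
    by exists (x - emb t *: y) => //; rewrite addrC addKr nrmN.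
  pose D := `|C| + 1; have D_gt0 : 0 < D by rewrite ltr_wpDl.
  exists (x', Num.min (r / 2) D^-1) => /= _; split.
  - by rewrite lt_min !divr_gt0 // invr_gt0.
  - by rewrite ge_min lexx.
  - have : Num.min (r / 2) D^-1 <= r / 2 by rewrite ge_min lexx.
    by rewrite x'x; lra.
  - exists n => z; rewrite le_min => /andP[_ zx'].
    have : nrm (T n x') <= nrm (T n z) + nrm (T n (z - x')).
      rewrite -[in leLHS](subKr z x') [in leLHS]TB.
      by apply: le_trans (nrmD _ _) _; rewrite nrmN.
    have : nrm (T n (z - x')) <= 1.
      apply: le_trans (TC _) _; rewrite -(@mulfV _ D) ?gt_eqF //.
      apply: (@le_trans _ _ (D * nrm (z - x'))); last by rewrite ler_pM2l.
      by rewrite ler_wpM2r ?nrm_ge0 // /D; have := ler_norm C; lra.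
    lra.
have [F FP] := choice (fun p : (H * R) * nat => step p.1 p.2).
pose q := fix q n := if n is m.+1 then F (q m, m) else (0 : H, 1 : R).
have q_gt0 n : 0 < (q n).2.
  elim: n => [|n IHn] /=; first exact: ltr01.
  by have [] := FP (q n, n) IHn.
have q_half n : (q n).2 <= 1 * 2^-1 ^+ n.
  elim: n => [|n IHn]; first by rewrite expr0 mulr1.
  have [_ le_half _ _] := FP (q n, n) (q_gt0 n).
  rewrite exprSr mulrA; apply: le_trans le_half _.
  by rewrite ler_wpM2r // invr_ge0.
have q_nest m n : (m <= n)%N -> nrm ((q n).1 - (q m).1) + (q n).2 <= (q m).2.
  elim: n => [|n IHn]; first by rewrite leqn0 => /eqP ->; rewrite subrr nrm0 add0r.
  rewrite leq_eqVlt => /orP[/eqP ->|/IHn {}IHn].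
    by rewrite subrr nrm0 add0r.
  have [_ _ + _] := FP (q n, n) (q_gt0 n).
  have := nrmD ((q n.+1).1 - (q n).1) ((q n).1 - (q m).1).
  by rewrite addrA subrK /=; lra.
have q_cvg0 : (fun n => (q n).2) @ \oo --> (0 : R).
  apply: (@squeeze_cvgr _ _ _ _ (cst 0) (geometric 1 2^-1)).
  - by near=> n; rewrite /= (ltW (q_gt0 n)) q_half.
  - exact: cvg_cst.
  - by apply: cvg_geometric; rewrite ger0_norm ?invf_lt1 // ltr1n.
have [x _ qx] := cvg_tail_bound q_cvg0 (u := fun n => (q n).1)
  (fun m n mn => le_trans (ltW (ltr_pwDr (q_gt0 n) (lexx _))) (q_nest m n mn)).
have [M TM] := Tptw x.
set L := (Num.truncn M).+1.
have [_ _ _ [n /(_ x (qx L.+1))]] := FP (q L, L) (q_gt0 L).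
rewrite leNgt => /negP; apply.
by rewrite (le_lt_trans (TM n)) // truncnS_gt.
Unshelve. all: by end_near. Qed.


(** * Square-summable coefficients and Bessel sequences *)

Definition sqsum (c : nat -> K) m n : R := \sum_(m <= i < n) mod (c i) ^+ 2.

Lemma sqsum_ge0 c m n : 0 <= sqsum c m n.
Proof. by apply: sumr_ge0 => i _; rewrite sqr_ge0. Qed.

Lemma sqsum_cat c m n : (m <= n)%N -> sqsum c 0 n = sqsum c 0 m + sqsum c m n.
Proof. by move=> mn; rewrite /sqsum (big_cat_nat (n := m)). Qed.

Lemma sqsum_le c m n : (m <= n)%N -> sqsum c 0 m <= sqsum c 0 n.
Proof. by move=> mn; rewrite (sqsum_cat c mn) lerDl sqsum_ge0. Qed.

Definition square_bounded (c : nat -> K) := exists C, forall n, sqsum c 0 n <= C.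

Lemma square_bounded_cvg c C : (forall n, sqsum c 0 n <= C) ->
  exists2 l, sqsum c 0 @ \oo --> l & forall n, sqsum c 0 n <= l.
Proof.
move=> cC; have ndc : nondecreasing_seq (sqsum c 0).
  by move=> m n mn; exact: sqsum_le.
have cvgc : cvgn (sqsum c 0).
  by apply: nondecreasing_is_cvgn => //; exists C => _ [n _ <-].
by exists (limn (sqsum c 0)) => // n; exact: nondecreasing_cvgn_le.
Qed.

(** Since the sums of squares increase, bounds that vary with the number of terms
    pass to the limit. Together with the form of the lower bound in
    [frame_bounds], this allows estimates on partial sums to be used without
    ever naming the sum of the series. *)
Lemma sqsum_le_lim c (t : nat -> R) l : (forall n, sqsum c 0 n <= t n) ->
  t @ \oo --> l -> forall n, sqsum c 0 n <= l.
Proof.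
move=> ct tl n; apply: (cvgr_to_ge tl); near=> m.
by apply: le_trans (ct m); apply: sqsum_le; near: m; exact: nbhs_infty_ge.
Unshelve. all: by end_near. Qed.

Lemma young r s t : 0 < t -> r * s <= (t * r ^+ 2 + t^-1 * s ^+ 2) / 2.
Proof.
move=> t_gt0; have : 0 <= t^-1 * (t * r - s) ^+ 2.
  by rewrite mulr_ge0 ?sqr_ge0 // invr_ge0 ltW.
have -> : t^-1 * (t * r - s) ^+ 2 = t * r ^+ 2 + t^-1 * s ^+ 2 - 2 * (r * s).
  by field; rewrite gt_eqF.
lra.
Qed.

Definition coef (g : nat -> H) h : nat -> K := fun i => ip h (g i).

Definition bessel (g : nat -> H) B := forall h n,
  sqsum (coef g h) 0 n <= B * nrm h ^+ 2.

Lemma sum_coef_young (f : nat -> H) h (c : nat -> K) t m n : 0 < t ->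
  mod (ip (\sum_(m <= i < n) c i *: f i) h) <=
    (t * sqsum c m n + t^-1 * sqsum (coef f h) m n) / 2.
Proof.
move=> t_gt0; rewrite ip_suml; apply: le_trans (mod_sum _ _ _) _.
rewrite /sqsum !mulr_sumr -big_split /= mulr_suml; apply: ler_sum => i _.
by rewrite ipZl modM (ipC h) mod_conj; exact: young.
Qed.

(** The synthesis operator of a Bessel sequence is bounded. With [y] the sum,
    [|y| ^ 2 = <y, y>] is the sum of the [c_i <g_i, y>], which Young's inequality
    with weight [B] bounds by [B |c| ^ 2 / 2 + |y| ^ 2 / 2]. *)
Lemma synthesis_bound g B c m n : 0 < B -> bessel g B -> (m <= n)%N ->
  nrm (\sum_(m <= i < n) c i *: g i) ^+ 2 <= B * sqsum c m n.
Proof.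
move=> B_gt0 gB mn; set y := \sum_(m <= i < n) _.
have := sum_coef_young g y c m n B_gt0; rewrite -/y ip_nrm mod_emb.
rewrite ger0_norm ?sqr_ge0 //.
have : B^-1 * sqsum (coef g y) m n <= nrm y ^+ 2.
  rewrite ler_pdivrMl //; apply: le_trans (gB y n).
  by rewrite (sqsum_cat _ mn) lerDr sqsum_ge0.
lra.
Qed.

Lemma series_tail (v : nat -> H) m n : (m <= n)%N ->
  series v n - series v m = \sum_(m <= i < n) v i.
Proof.
by move=> mn; rewrite /series /= (big_cat_nat (n := m)) //= [X in X - _]addrC addrK.
Qed.

Lemma bessel_series_cvg g B c : 0 < B -> bessel g B -> square_bounded c ->
  cvgn (series (fun i => c i *: g i)).
Proof.
move=> B_gt0 gB [C cC]; have [l cl c_le_l] := square_bounded_cvg cC.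
have rho0 : (fun n => Num.sqrt (B * (l - sqsum c 0 n))) @ \oo --> (0 : R).
  rewrite -(@sqrtr0 R); apply: continuous_cvg; first exact: sqrt_continuous.
  rewrite -(mulr0 B) -(subrr l).
  by apply: cvgM; [exact: cvg_cst|apply: cvgB => //; exact: cvg_cst].
have [//|x ux _] := cvg_tail_bound rho0 (u := series (fun i => c i *: g i)).
  move=> m n mn; rewrite series_tail // -ler_sqr ?nnegrE ?nrm_ge0 ?sqrtr_ge0 //.
  rewrite sqr_sqrtr; last by rewrite mulr_ge0 ?(ltW B_gt0) // subr_ge0.
  apply: le_trans (synthesis_bound c B_gt0 gB mn) _.
  by rewrite ler_pM2l // lerBrDl -sqsum_cat.
by apply/cvg_ex; exists x.
Qed.

(** * Frames and mixed frame operators *)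

(** The lower inequality is tested on all upper bounds of the partial sums, which
    is the same as testing it on their limit. *)
Definition frame_bounds (g : nat -> H) A B := [/\ 0 < A, 0 < B, bessel g B &
  forall h C, (forall n, sqsum (coef g h) 0 n <= C) -> A * nrm h ^+ 2 <= C].

(** [s_pseudo_dual ip g f] says that [mixed_op g f h] tends to [h] for all [h], and
    [a_pseudo_dual ip g f] is [s_pseudo_dual ip f g]. *)
Definition mixed_op (g f : nat -> H) h : nat -> H :=
  series (fun i => ip h (g i) *: f i).

Lemma mixed_adjoint g f h y n : ip (mixed_op g f h n) y = ip h (mixed_op f g y n).
Proof.
rewrite /mixed_op /series /= ip_suml ip_sumr; apply: eq_bigr => i _.
by rewrite ipZl ipZr -ipC mulrC.
Qed.

Lemma mixed_linear g f n a x y :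
  mixed_op g f (a *: x + y) n = a *: mixed_op g f x n + mixed_op g f y n.
Proof.
rewrite /mixed_op /series /= scaler_sumr -big_split; apply: eq_bigr => i _ /=.
by rewrite ipDl ipZl scalerDl scalerA.
Qed.

Lemma mixed_bounded g f n : exists C, forall h, nrm (mixed_op g f h n) <= C * nrm h.
Proof.
exists (\sum_(0 <= i < n) nrm (g i) * nrm (f i)) => h.
apply: le_trans (nrm_sum _ _ _) _; rewrite mulr_suml; apply: ler_sum => i _.
by rewrite nrmZ mulrAC ler_wpM2r ?nrm_ge0 // mulrC cauchy_schwarz.
Qed.

Lemma mixed_self g h n : ip (mixed_op g g h n) h = emb (sqsum (coef g h) 0 n).
Proof.
rewrite /mixed_op /series /= ip_suml rmorph_sum /=; apply: eq_bigr => i _.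
by rewrite ipZl (ipC h) mul_conj_mod.
Qed.

Lemma mixed_self_cvg g B h : 0 < B -> bessel g B -> cvgn (mixed_op g g h).
Proof.
by move=> B_gt0 gB; exact: (bessel_series_cvg B_gt0 gB (ex_intro _ _ (gB h))).
Qed.

(** * The frame operator *)

Lemma nrmB_sqr s t x y : ip y x = emb s ->
  nrm (x - emb t *: y) ^+ 2 = nrm x ^+ 2 - 2 * t * s + t ^+ 2 * nrm y ^+ 2.
Proof.
move=> yx; apply: emb_inj; rewrite -ip_nrm ipBl !ipBr !ipZl !ipZr !ip_nrm.
rewrite (ipC y x) yx !(conj_emb sc) !rmorphD rmorphN !rmorphM /=.
by rewrite (rmorph_nat emb); ring.
Qed.

(** Richardson's iteration [z <- z + B^-1 (x - F z)] for the frame operator [F]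
    converges: the residual is multiplied by [1 - B^-1 F], and
    [|y - B^-1 F y| ^ 2 = |y| ^ 2 - 2 B^-1 <F y, y> + B^-2 |F y| ^ 2] is at most
    [|y| ^ 2 - B^-1 <F y, y> <= (1 - A / B) |y| ^ 2] because
    [|F y| ^ 2 <= B <F y, y>]. *)
Lemma frame_operator_surjective g A B x : frame_bounds g A B ->
  exists h, mixed_op g g h @ \oo --> x.
Proof.
move=> [A_gt0 B_gt0 gB gA]; pose F h := limn (mixed_op g g h).
have F_cvg h : mixed_op g g h @ \oo --> F h by exact: mixed_self_cvg gB.
have F_lin a y z : F (a *: y + z) = a *: F y + F z.
  apply: cvg_lim; first exact: norm_hausdorff.
  rewrite (_ : mixed_op g g _ = (fun n => a *: mixed_op g g y n + mixed_op g g z n)).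
    by apply: cvgD => //; apply: cvgZl_tmp.
  by apply/funext => n; exact: mixed_linear.
have F_bound h : nrm (F h) <= B * nrm h.
  apply: (cvgr_to_le (cvg_nrm (F_cvg h))); near=> n.
  rewrite -ler_sqr ?nnegrE ?mulr_ge0 ?nrm_ge0 ?(ltW B_gt0) //.
  apply: le_trans (synthesis_bound _ B_gt0 gB (leq0n n)) _.
  by rewrite exprMn expr2 -mulrA ler_pM2l //; exact: gB.
have contract y : nrm (y - emb B^-1 *: F y) ^+ 2 <= (1 - A / B) * nrm y ^+ 2.
  have : A * nrm y ^+ 2 <= B * (nrm y ^+ 2 - nrm (y - emb B^-1 *: F y) ^+ 2).
    apply: gA; apply: (@sqsum_le_lim _ (fun n => B * (nrm y ^+ 2 -
        nrm (y - emb B^-1 *: mixed_op g g y n) ^+ 2))) => [n|].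
      rewrite (nrmB_sqr _ (mixed_self g y n)).
      have := synthesis_bound (coef g y) B_gt0 gB (leq0n n).
      rewrite -/(mixed_op g g y n) -/(series _ _).
      set s := sqsum _ _ _; set w := nrm (series _ _).
      move=> ws; rewrite -subr_ge0.
      rewrite (_ : _ - s = B^-1 * (B * s - w ^+ 2)).
        by rewrite mulr_ge0 ?subr_ge0 // invr_ge0 ltW.
      by field; rewrite gt_eqF.
    apply: cvgMl_tmp; apply: cvgB; first exact: cvg_cst.
    suff w : (fun n => nrm (y - emb B^-1 *: mixed_op g g y n)) @ \oo -->
      nrm (y - emb B^-1 *: F y)
      by under eq_fun do rewrite expr2; rewrite expr2; exact: cvgM.
    apply: cvg_nrm; apply: cvgB; first exact: cvg_cst.
    by apply: cvgZl_tmp.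
  rewrite -ler_pdivrMl // => le1.
  by rewrite mulrBl mul1r (mulrC A) -mulrA; lra.
have F0 : F 0 = 0.
  by have := F_lin (-1) 0 0; rewrite scaler0 add0r scaleN1r addNr.
(* When [B < A], which only happens in the zero space, the square root is 0 and
   the estimates below remain true. *)
pose q := Num.sqrt (1 - A / B).
have q_ge0 : 0 <= q by exact: sqrtr_ge0.
have q_lt1 : q < 1.
  by rewrite -sqrtr1 ltr_sqrt ?ltr01 // ltrBlDr ltrDl divr_gt0.
have contract_q y : nrm (y - emb B^-1 *: F y) <= q * nrm y.
  rewrite -ler_sqr ?nnegrE ?mulr_ge0 ?nrm_ge0 //.
  apply: le_trans (contract y) _; rewrite exprMn ler_wpM2r ?sqr_ge0 //.
  have [ge0|lt0] := lerP 0 (1 - A / B); first by rewrite sqr_sqrtr.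
  by rewrite (le_trans (ltW lt0)) ?sqr_ge0.
pose z := fix z n : H :=
  if n is m.+1 then emb B^-1 *: (x - F (z m)) + z m else 0.
have residual n : nrm (x - F (z n)) <= q ^+ n * nrm x.
  elim: n => [|n IHn]; first by rewrite /= F0 subr0 expr0 mul1r.
  rewrite /= F_lin opprD addrCA addrC exprS -mulrA.
  apply: le_trans (contract_q _) _; exact: ler_wpM2l.
(* The sum of the bounds [B^-1 q ^ n |x|] on the steps of the iteration. *)
pose C := B^-1 * nrm x / (1 - q).
have C_ge0 : 0 <= C.
  by rewrite !mulr_ge0 ?invr_ge0 ?nrm_ge0 // ?subr_ge0 ltW.
have z_step m n : (m <= n)%N -> nrm (z n - z m) <= C * (q ^+ m - q ^+ n).
  elim: n => [|n IHn].
    by rewrite leqn0 => /eqP ->; rewrite !subrr nrm0 mulr0.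
  rewrite leq_eqVlt => /orP[/eqP ->|/IHn {}IHn].
    by rewrite !subrr nrm0 mulr0.
  rewrite [z n.+1]/= -addrA; apply: le_trans (nrmD _ _) _.
  rewrite nrmZ mod_emb gtr0_norm ?invr_gt0 //.
  have := residual n; rewrite -(@ler_pM2l _ B^-1) ?invr_gt0 //.
  have -> : B^-1 * (q ^+ n * nrm x) = C * (q ^+ n - q ^+ n.+1).
    by rewrite /C exprS; field; rewrite subr_eq0 !gt_eqF.
  by move: IHn; rewrite !mulrBr; lra.
have geo : (fun n => C * q ^+ n) @ \oo --> (0 : R).
  rewrite -(mulr0 C); apply: cvgM; first exact: cvg_cst.
  by apply: cvg_expr; rewrite ger0_norm.
have [w _ zw] : exists2 w, z @ \oo --> w & forall m, nrm (w - z m) <= C * q ^+ m.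
  apply: cvg_tail_bound geo _ => m n mn; apply: le_trans (z_step _ _ mn) _.
  by rewrite ler_wpM2l // lerBlDr lerDl exprn_ge0.
exists w; suff -> : x = F w by [].
apply/eqP; rewrite -subr_eq0; apply/eqP/nrm0_eq0/eqP; rewrite eq_le nrm_ge0 andbT.
have lim0 : (fun n => q ^+ n * nrm x + B * (C * q ^+ n)) @ \oo --> (0 : R).
  rewrite -(addr0 0); apply: cvgD.
    rewrite -(mul0r (nrm x)); apply: cvgM; last exact: cvg_cst.
    by apply: cvg_expr; rewrite ger0_norm.
  by rewrite -(mulr0 B); apply: cvgM; first exact: cvg_cst.
apply: (cvgr_to_ge lim0); near=> n.
rewrite (_ : x - F w = (x - F (z n)) - F (-1 *: z n + w)); last first.
  by rewrite F_lin scaleN1r opprD opprK addrA subrK.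
apply: le_trans (nrmD _ _) _; rewrite nrmN lerD //.
apply: le_trans (F_bound _) _; rewrite ler_pM2l // scaleN1r addrC.
exact: zw.
Unshelve. all: by end_near. Qed.


(** [A |h| ^ 2 <= <F h, h> <= |F h| |h|]. *)
Lemma frame_operator_lower g A B h x : frame_bounds g A B ->
  mixed_op g g h @ \oo --> x -> A * nrm h <= nrm x.
Proof.
move=> [A_gt0 _ _ gA] hx.
have : A * nrm h ^+ 2 <= nrm x * nrm h.
  apply: gA; apply: (@sqsum_le_lim _ (fun n => nrm (mixed_op g g h n) * nrm h)).
    move=> n; have := cauchy_schwarz (mixed_op g g h n) h.
    by rewrite mixed_self mod_emb ger0_norm ?sqsum_ge0.
  by apply: cvgM; [exact: cvg_nrm|exact: cvg_cst].
have [->|h_neq0] := eqVneq (nrm h) 0; first by rewrite !mulr0 nrm_ge0.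
by rewrite expr2 mulrA ler_pM2r // lt_neqAle eq_sym h_neq0 nrm_ge0.
Qed.

(** * Finite-dimensional spaces of sequences *)

(** Finitely many coordinates determine a sequence in the span of finitely many
    ones: [c = \sum_(i < N) c_i E_i]. When a new sequence [e n] is added, let [w]
    be the difference between [e n] and its interpolation by the old [E_i]. If
    [w] vanishes nothing has to be changed; otherwise, choosing [p] with
    [w p != 0], the multiple of [w] that corrects the value at [p] is added to
    the interpolation. This changes nothing on the old span, where the correction
    is zero. *)
Lemma interpolation (P : (nat -> K) -> Prop) (e : nat -> nat -> K) n :
  P (fun=> 0) -> (forall a c d, P c -> P d -> P (fun i => a * c i + d i)) ->
  (forall j, (j < n)%N -> P (e j)) ->
  exists N (E : nat -> nat -> K), (forall i, P (E i)) /\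
    forall j m, (j < n)%N -> e j m = \sum_(0 <= i < N) e j i * E i m.
Proof.
move=> P0 Plin; elim: n => [|n IHn] eP.
  by exists 0%N, (fun _ _ => 0); split.
have [j jn|N [E [EP eE]]] := IHn; first by apply: eP; exact: ltnW.
pose L (c : nat -> K) m := \sum_(0 <= i < N) c i * E i m.
pose w m := e n m - L (e n) m.
have Pext c d : c =1 d -> P c -> P d by move=> /funext ->.
have PL c : P (L c).
  rewrite /L; elim: N {eE w L} => [|N IHN].
    by apply: Pext P0 => m; rewrite big_geq.
  apply: Pext (Plin (c N) _ _ (EP N) IHN) => m.
  by rewrite big_nat_recr //= addrC.
have Pw : P w.
  apply: Pext (Plin (-1) _ _ (PL (e n)) (eP n (ltnSn n))) => m.
  by rewrite /w mulN1r addrC.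
have [w0|] := pselect (forall m, w m = 0).
  exists N, E; split => // j m; rewrite ltnS leq_eqVlt => /orP[/eqP ->|].
    by apply/eqP; rewrite -subr_eq0; apply/eqP; exact: w0.
  exact: eE.
move=> /existsNP[p /eqP wp_neq0].
pose E0 i m := if (i < N)%N then E i m else 0.
pose E' i m := ((i == p)%:R - E0 i p) / w p * w m + E0 i m.
have PE0 i : P (E0 i).
  by rewrite /E0; case: (i < N)%N; [exact: EP|exact: P0].
exists (maxn N p.+1), E'; split=> [i|j m]; first exact: Plin.
have LE0 c q : \sum_(0 <= i < maxn N p.+1) c i * E0 i q = L c q.
  rewrite /L (big_nat_widen _ _ _ _ _ (leq_maxl N p.+1)) [RHS]big_mkcond /=.
  by apply: eq_bigr => i _; rewrite /E0; case: ifP => //; rewrite mulr0.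
have -> : \sum_(0 <= i < maxn N p.+1) e j i * E' i m =
    (e j p - L (e j) p) / w p * w m + L (e j) m.
  rewrite -!LE0.
  have -> : e j p = \sum_(0 <= i < maxn N p.+1) e j i * (i == p)%:R.
    rewrite (bigD1_seq p) ?iota_uniq ?mem_index_iota ?leq_maxr //= eqxx mulr1.
    by rewrite big1 ?addr0 // => i /negbTE ->; rewrite mulr0.
  rewrite -sumrB !mulr_suml -big_split; apply: eq_bigr => i _ /=.
  by rewrite /E' mulrDr -mulrBr !mulrA.
rewrite ltnS leq_eqVlt => /orP[/eqP ->|jn].
  by rewrite -/(w p) divff // mul1r /w subrK.
by rewrite /L -!eE // subrr !mul0r add0r.
Qed.

Lemma sqsumD c d m n :
  sqsum (fun i => c i + d i) m n <= 2 * sqsum c m n + 2 * sqsum d m n.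
Proof.
rewrite /sqsum !mulr_sumr -big_split; apply: ler_sum => i _ /=.
have : mod (c i + d i) ^+ 2 <= (mod (c i) + mod (d i)) ^+ 2.
  by rewrite ler_sqr ?nnegrE ?addr_ge0 ?mod_ge0 // modD.
have := sqr_ge0 (mod (c i) - mod (d i)); rewrite sqrrB sqrrD; lra.
Qed.

Lemma sqsumZ a c m n : sqsum (fun i => a * c i) m n = mod a ^+ 2 * sqsum c m n.
Proof. by rewrite /sqsum mulr_sumr; apply: eq_bigr => i _; rewrite modM exprMn. Qed.

Lemma square_bounded_linear a c d : square_bounded c -> square_bounded d ->
  square_bounded (fun i => a * c i + d i).
Proof.
move=> [C cC] [D dD]; exists (2 * (mod a ^+ 2 * C) + 2 * D) => n.
apply: le_trans (sqsumD _ _ _ _) _; rewrite sqsumZ.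
apply: lerD; rewrite ler_pM2l ?ltr0n //.
by rewrite ler_wpM2l ?sqr_ge0.
Qed.

(** The map [c |-> \sum_(i < N) c_i E_i] from the first [N] coordinates to l2 is
    bounded; the constant is not optimal. *)
Lemma sqsum_combination (E : nat -> nat -> K) N :
  (forall i, square_bounded (E i)) -> exists2 C, 0 <= C & forall c m,
    sqsum (fun m => \sum_(0 <= i < N) c i * E i m) 0 m <= C * sqsum c 0 N.
Proof.
move=> EC; elim: N => [|N [C C_ge0 IHN]].
  exists 0 => // c m; rewrite mul0r /sqsum big1 // => i _.
  by rewrite big_geq // mod0 expr0n.
have [D DE] := EC N; have D_ge0 : 0 <= D by apply: le_trans (DE 0%N); exact: sqsum_ge0.
exists (2 * C + 2 * D) => [|c m]; first by rewrite addr_ge0 // mulr_ge0.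
rewrite (_ : (fun m => _) = (fun m =>
  \sum_(0 <= i < N) c i * E i m + c N * E N m)); last first.
  by apply/funext => i; rewrite big_nat_recr.
apply: le_trans (sqsumD _ _ _ _) _; rewrite sqsumZ.
have -> : sqsum c 0 N.+1 = sqsum c 0 N + mod (c N) ^+ 2.
  by rewrite /sqsum big_nat_recr.
have := IHN c m; have := ler_wpM2l (sqr_ge0 (mod (c N))) (DE m).
have := mulr_ge0 D_ge0 (sqsum_ge0 c 0 N).
have := mulr_ge0 C_ge0 (sqr_ge0 (mod (c N))).
rewrite !mulrDr !mulrDl -!mulrA; lra.
Qed.

Lemma series_sqr_norm c :
  series (fun i => `|c i| ^+ 2) = (fun n => emb (sqsum c 0 n)).
Proof.
apply/funext => n; rewrite /series /= /sqsum rmorph_sum; apply: eq_bigr => i _ /=.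
by rewrite rmorphXn /= emb_mod.
Qed.

Lemma ell2P c : ell2 c <-> square_bounded c.
Proof.
rewrite /ell2 /= series_sqr_norm; split=> [/cvg_ex[l /cvgrPdist_lt cl]|[C cC]].
  exists (mod l + 1) => n.
  have [N _ lN] := cl 1 ltr01.
  apply: le_trans (sqsum_le c (leq_maxl n N)) _.
  have := lN (maxn n N) (leq_maxr n N); set s := sqsum _ _ _ => ls.
  rewrite -ler_emb rmorphD rmorph1 /= emb_mod.
  rewrite -[emb s]ger0_norm; last by rewrite -emb0 ler_emb sqsum_ge0.
  rewrite -(subKr l (emb s)); apply: le_trans (ler_normB _ _) _.
  by rewrite lerD2l ltW.
have [l cl _] := square_bounded_cvg cC.
by apply/cvg_ex; exists (emb l); exact: cvg_emb.
Qed.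

(** On the kernel, the l2 norm is equivalent to the norm of the first [N]
    coordinates, since these determine a kernel vector linearly. *)
Lemma kernel_head_bound (g : nat -> H) : finite_dimensional (synthesis_ker g) ->
  exists N C, 0 <= C /\ forall c, square_bounded c -> synthesis g c = 0 ->
    forall m, sqsum c 0 m <= C * sqsum c 0 N.
Proof.
move=> [n [e [e_ker e_span]]].
pose e' j := oapp e (fun=> 0) (insub j).
have e'E (i : 'I_n) : e' i = e i by rewrite /e' valK.
have [||j jn|N [E [E_bdd eE]]] := @interpolation square_bounded e' n.
- by exists 0 => m; rewrite /sqsum big1 // => i _; rewrite mod0 expr0n.
- exact: square_bounded_linear.
- have [+ _] := e_ker (Ordinal jn).
  by rewrite -[e' j]/(e' (Ordinal jn)) e'E => /ell2P.
have [C C_ge0 EC] := sqsum_combination N E_bdd.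
exists N, C; split => // c c_bdd c_ker m.
have [|a cE] := e_span c; first by split => //; exact/ell2P.
have cE' i : c i = \sum_(j < n) a j * e' j i.
  by rewrite cE fct_sumE; apply: eq_bigr => j _; rewrite e'E.
rewrite {1}(_ : c = (fun m => \sum_(0 <= i < N) c i * E i m)); first exact: EC.
apply/funext => i; rewrite cE'.
under [RHS]eq_bigr => l _ do rewrite cE' mulr_suml.
rewrite exchange_big /=; apply: eq_bigr => j _.
by rewrite {1}eE // mulr_sumr; apply: eq_bigr => l _; rewrite mulrA.
Qed.


(** * Removing finitely many elements of the frame *)

(** The elements [g_i] with [N <= i] have a lower Riesz bound. A coefficient
    sequence [c] supported there and the canonical coefficients [<h, g_i>] of
    its synthesis [x] differ by a kernel vector whose first [N] coordinates are,
    up to sign, the canonical ones, so [kernel_head_bound] bounds [c] in terms of the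
    canonical coefficients, hence of [x]. *)
Lemma tail_riesz_bound g A B : frame_bounds g A B ->
  finite_dimensional (synthesis_ker g) ->
  exists N D, 0 <= D /\ forall c n, (N <= n)%N ->
    sqsum c N n <= D * nrm (\sum_(N <= i < n) c i *: g i) ^+ 2.
Proof.
move=> gAB /kernel_head_bound[N [C [C_ge0 ker_head]]].
have [A_gt0 B_gt0 gB _] := gAB.
exists N, (2 * (C + 1) * B / A ^+ 2).
split=> [|c n Nn].
  by rewrite !mulr_ge0 ?invr_ge0 ?sqr_ge0 ?addr_ge0 // ltW.
set x := \sum_(N <= i < n) _.
have [h hx] := frame_operator_surjective x gAB.
pose c' i := if (N <= i < n)%N then c i else 0.
pose d i := -1 * coef g h i + c' i.
have h_bdd : square_bounded (coef g h) by exists (B * nrm h ^+ 2).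
have c'_series m : (n <= m)%N -> series (fun i => c' i *: g i) m = x.
  move=> nm; rewrite /x -(sum_window _ Nn nm); apply: eq_bigr => i _.
  by rewrite /c'; case: ifP => // _; rewrite scale0r.
have c'_sqsum m : (n <= m)%N -> sqsum c' 0 m = sqsum c N n.
  move=> nm; rewrite /sqsum -(sum_window _ Nn nm); apply: eq_bigr => i _.
  by rewrite /c'; case: ifP => // _; rewrite mod0 expr0n.
have c'_bdd : square_bounded c'.
  exists (sqsum c' 0 n) => m.
  apply: le_trans (sqsum_le c' (leq_maxl m n)) _.
  by rewrite !c'_sqsum // leq_maxr.
have d_bdd : square_bounded d by exact: square_bounded_linear.
have d_ker : synthesis g d = 0.
  apply: cvg_lim; first exact: norm_hausdorff.
  rewrite (_ : series _ = series (fun i => c' i *: g i) - mixed_op g g h); last first.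
    apply/funext => m; rewrite /series /mixed_op /= fctE -sumrB.
    by apply: eq_bigr => i _; rewrite /d mulN1r scalerDl scaleNr addrC.
  rewrite -(subrr x); apply: cvgB => //; apply: cvg_near_cst.
  by near=> m; apply: c'_series; near: m; exact: nbhs_infty_ge.
have head_d : sqsum d 0 N = sqsum (coef g h) 0 N.
  apply: eq_big_nat => i /andP[_ iN].
  by rewrite /d /c' leqNgt iN addr0 mulN1r modN.
have Ah := frame_operator_lower gAB hx.
have h_le : nrm h ^+ 2 <= nrm x ^+ 2 / A ^+ 2.
  rewrite ler_pdivlMr ?exprn_gt0 // mulrC -exprMn.
  by rewrite ler_sqr ?nnegrE ?mulr_ge0 ?nrm_ge0 // ltW.
rewrite -(c'_sqsum n (leqnn n)).
rewrite (_ : c' = fun i => d i + coef g h i); last first.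
  by apply/funext => i; rewrite /d mulN1r addrC addrA subrr add0r.
apply: le_trans (sqsumD _ _ _ _) _.
have := ker_head d d_bdd d_ker n; rewrite head_d => dC.
have := ler_wpM2l C_ge0 (gB h N); have := gB h n => hn hN.
apply: (@le_trans _ _ (2 * (C + 1) * B * nrm h ^+ 2)).
  by rewrite -!mulrA mulrDl mul1r; lra.
rewrite -[leRHS]mulrA ler_wpM2l //; last by rewrite mulrC.
by rewrite !mulr_ge0 ?addr_ge0 // ltW.
Unshelve. all: by end_near. Qed.

(** * Pseudo-duals are Bessel sequences *)

Lemma uniformly_bounded_mixed g f :
  (forall h, cvgn (mixed_op g f h)) ->
  exists2 M, 0 <= M & forall n h, nrm (mixed_op g f h n) <= M * nrm h.
Proof.
move=> gf; apply: (@uniform_boundedness (fun n h => mixed_op g f h n)).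
- by move=> n a x y; exact: mixed_linear.
- exact: mixed_bounded.
- move=> h; have /cvg_ex[l hl] := gf h.
  have /cvg_seq_bounded : cvgn (fun n => nrm (mixed_op g f h n)).
    by apply/cvg_ex; exists (nrm l); exact: cvg_nrm.
  move=> [M [_ /(_ (M + 1))]]; rewrite ltrDl => /(_ ltr01) hM; exists (M + 1) => n.
  by have := hM n Logic.I; rewrite /= ger0_norm ?nrm_ge0.
Qed.

(** With [u] the partial sum of [<h, f_i> g_i], [|u| ^ 2 = <u, u>] is the inner
    product of [h] with a partial sum of [<u, g_i> f_i]. *)
Lemma adjoint_uniformly_bounded g f M : 0 <= M ->
  (forall n h, nrm (mixed_op g f h n) <= M * nrm h) ->
  forall n h, nrm (mixed_op f g h n) <= M * nrm h.
Proof.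
move=> M_ge0 gfM n h; set u := mixed_op f g h n.
have [->|u_neq0] := eqVneq (nrm u) 0; first by rewrite mulr_ge0 ?nrm_ge0.
have u_gt0 : 0 < nrm u by rewrite lt_neqAle eq_sym u_neq0 nrm_ge0.
rewrite -(ler_pM2r u_gt0) -expr2.
rewrite -[nrm u ^+ 2]ger0_norm ?sqr_ge0 // -(@mod_emb _) -ip_nrm {1}/u.
rewrite mixed_adjoint; apply: le_trans (cauchy_schwarz _ _) _.
by rewrite [M * _]mulrC -mulrA ler_wpM2l ?nrm_ge0.
Qed.

(** For [N <= i < n] the coefficients [<h, f_i>] synthesize the difference of two
    partial sums, of norm at most [2 M |h|], so [tail_riesz_bound] applies; each
    of the first [N] coefficients is bounded by Cauchy-Schwarz. *)
Lemma bounded_mixed_bessel g f A B M : frame_bounds g A B ->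
  finite_dimensional (synthesis_ker g) ->
  (forall n h, nrm (mixed_op f g h n) <= M * nrm h) ->
  exists2 B', 0 < B' & bessel f B'.
Proof.
move=> gAB /(tail_riesz_bound gAB)[N [D [D_ge0 tail]]] fgM.
pose Q := \sum_(0 <= i < N) nrm (f i) ^+ 2.
have Q_ge0 : 0 <= Q by apply: sumr_ge0 => i _; exact: sqr_ge0.
have head h : sqsum (coef f h) 0 N <= Q * nrm h ^+ 2.
  rewrite /sqsum /Q mulr_suml; apply: ler_sum => i _.
  rewrite -exprMn ler_sqr ?nnegrE ?mulr_ge0 ?nrm_ge0 ?mod_ge0 //.
  by rewrite mulrC cauchy_schwarz.
have c_ge0 : 0 <= D * (2 * M) ^+ 2 by rewrite mulr_ge0 ?sqr_ge0.
exists (Q + D * (2 * M) ^+ 2 + 1) => [|h n].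
  by rewrite ltr_wpDl // addr_ge0.
apply: le_trans (sqsum_le _ (leq_maxl n N)) _.
rewrite (sqsum_cat _ (leq_maxr n N)).
have -> : forall r s t : R, (r + s + 1) * t = r * t + (s * t + t).
  by move=> r s t; ring.
apply: lerD => //; rewrite ler_wpDr ?sqr_ge0 //.
apply: le_trans (tail _ _ (leq_maxr n N)) _.
rewrite -mulrA ler_wpM2l // -exprMn ler_sqr ?nnegrE ?nrm_ge0 //; last first.
  by rewrite -mulrA mulr_ge0 //; apply: le_trans (nrm_ge0 _) (fgM 0%N h).
rewrite -(series_tail (fun i => coef f h i *: g i) (leq_maxr n N)).
apply: le_trans (nrmD _ _) _; rewrite nrmN.
have := fgM N h; have := fgM (maxn n N) h; rewrite /mixed_op /coef; lra.
Qed.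

(** * Duality of Bessel sequences *)

(** The synthesis operator of one sequence after the analysis operator of the
    other converges by the Bessel bounds, and its limit is identified weakly:
    it is the adjoint of an operator assumed to be the identity. *)
Lemma s_pseudo_dual_sym g f B B' : 0 < B -> 0 < B' -> bessel g B -> bessel f B' ->
  s_pseudo_dual ip g f -> s_pseudo_dual ip f g.
Proof.
move=> B_gt0 B'_gt0 gB fB' gf h.
have /cvg_ex[x hx] : cvgn (mixed_op f g h).
  exact: (bessel_series_cvg B_gt0 gB (ex_intro _ _ (fB' h))).
suff xh : x = h by move: hx; rewrite xh.
apply/eqP; rewrite -subr_eq0; apply/eqP/nrm0_eq0; set y := x - h.
suff : nrm y ^+ 2 <= 0.
  by move=> y0; apply/eqP; rewrite -sqrf_eq0 eq_le y0 sqr_ge0.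
have /cvg_nrmP hx0 := hx; have /cvg_nrmP hy0 := gf y.
have lim0 : (fun n => nrm (x - mixed_op f g h n) * nrm y +
    nrm h * nrm (y - mixed_op g f y n)) @ \oo --> (0 : R).
  rewrite -(addr0 0); apply: cvgD.
    by rewrite -(mul0r (nrm y)); apply: cvgM => //; exact: cvg_cst.
  by rewrite -(mulr0 (nrm h)); apply: cvgM => //; exact: cvg_cst.
apply: (cvgr_to_ge lim0); near=> n.
have -> : nrm y ^+ 2 = mod (ip (x - mixed_op f g h n) y - ip h (y - mixed_op g f y n)).
  rewrite ipBl ipBr mixed_adjoint opprB addrA subrK -ipBl ip_nrm mod_emb.
  by rewrite ger0_norm ?sqr_ge0.
apply: le_trans (modD _ _) _; rewrite modN.
by apply: lerD; exact: cauchy_schwarz.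
Unshelve. all: by end_near. Qed.

(** [|h| ^ 2] is the sum of the [<h, g_i> <f_i, h>], which by Young's inequality
    with weight [B^-1] is at most [|h| ^ 2 / 2 + (B / 2) C] for any bound [C] on the
    sums of [|<h, f_i>| ^ 2]. This is the lower frame inequality with constant
    [B^-1]. *)
Lemma dual_frame_bounds g f B B' : 0 < B -> 0 < B' -> bessel g B -> bessel f B' ->
  s_pseudo_dual ip g f -> frame_bounds f B^-1 B'.
Proof.
move=> B_gt0 B'_gt0 gB fB' gf; split; rewrite ?invr_gt0 // => h C fC.
suff : nrm h ^+ 2 <= (nrm h ^+ 2 + B * C) / 2.
  by move=> ?; rewrite ler_pdivrMl //; lra.
have lim : (fun n => (nrm h ^+ 2 + B * C) / 2 + nrm (h - mixed_op g f h n) * nrm h)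
    @ \oo --> (nrm h ^+ 2 + B * C) / 2.
  rewrite -[X in _ --> X]addr0; apply: cvgD; first exact: cvg_cst.
  rewrite -(mul0r (nrm h)); apply: cvgM; last exact: cvg_cst.
  exact/cvg_nrmP/gf.
apply: (cvgr_to_ge lim); near=> n.
have hE : nrm h ^+ 2 = mod (ip (mixed_op g f h n) h + ip (h - mixed_op g f h n) h).
  by rewrite -ipDl addrC subrK ip_nrm mod_emb ger0_norm ?sqr_ge0.
rewrite [leLHS]hE.
apply: le_trans (modD _ _) _; apply: lerD; last exact: cauchy_schwarz.
have Bi_gt0 : 0 < B^-1 by rewrite invr_gt0.
apply: le_trans (sum_coef_young f h (coef g h) 0 n Bi_gt0) _.
rewrite invrK ler_pM2r ?invr_gt0 //; apply: lerD; last by rewrite ler_pM2l.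
by rewrite ler_pdivrMl //; exact: gB.
Unshelve. all: by end_near. Qed.

(** Turns the frame inequalities, between elements of the scalar field, into
    inequalities between real numbers. *)
Lemma is_frameP g : is_frame ip g <-> exists A B, frame_bounds g A B.
Proof.
split=> [[A [B [A_gt0 B_gt0 gAB]]]|[A [B [A_gt0 B_gt0 gB gA]]]].
  have AE := emb_gt0_norm A_gt0; have BE := emb_gt0_norm B_gt0.
  move: (mod A) (mod B) AE BE => A' B' AE BE; subst A B.
  exists A', B'.
  have A'_gt0 : 0 < A' by rewrite -ltr_emb emb0.
  have B'_gt0 : 0 < B' by rewrite -ltr_emb emb0.
  have real_limit h : exists l, [/\ forall n, sqsum (coef g h) 0 n <= l,
      sqsum (coef g h) 0 @ \oo --> l & A' * nrm h ^+ 2 <= l <= B' * nrm h ^+ 2].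
    have [cvg_h] := gAB h.
    have /ell2P[C hC] : ell2 (coef g h) by [].
    have [l hl h_le] := square_bounded_cvg hC.
    have -> : limn (series (fun i => `|ip h (g i)| ^+ 2)) = emb l.
      apply: cvg_lim; first exact: norm_hausdorff.
      by rewrite (series_sqr_norm (coef g h)); exact: cvg_emb.
    rewrite -emb_nrm -rmorphXn -!rmorphM !ler_emb => lAB.
    by exists l.
  split=> //.
  - by move=> h n; have [l [/(_ n) hl _ /andP[_]]] := real_limit h; exact: le_trans.
  - move=> h C hC; have [l [_ hl /andP[Al _]]] := real_limit h.
    by apply: le_trans Al _; apply: (cvgr_to_le hl); apply: nearW.
exists (emb A), (emb B); split; rewrite -?emb0 ?ltr_emb // => h.
rewrite (series_sqr_norm (coef g h)) /=.
have [l hl h_le] := square_bounded_cvg (gB h).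
have hl' := cvg_emb hl; split; first by apply/cvg_ex; exists (emb l).
rewrite (cvg_lim _ hl'); last exact: norm_hausdorff.
rewrite -emb_nrm -rmorphXn -!rmorphM !ler_emb gA //=.
by apply: (cvgr_to_le hl); apply: nearW => n; exact: gB.
Qed.

(** * The equivalence *)

Lemma pseudo_dual_bessel g f A B : frame_bounds g A B ->
  finite_dimensional (synthesis_ker g) ->
  s_pseudo_dual ip g f \/ a_pseudo_dual ip g f ->
  exists2 B', 0 < B' & bessel f B'.
Proof.
move=> gAB ker_fin gf; suff [M fgM] : exists M, forall n h,
    nrm (mixed_op f g h n) <= M * nrm h by exact: bounded_mixed_bessel gAB ker_fin fgM.
case: gf => gf.
  have [|M M_ge0 gfM] := @uniformly_bounded_mixed g f.
    by move=> h; apply/cvg_ex; exists h; exact: gf.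
  by exists M; exact: adjoint_uniformly_bounded.
have [|M _ fgM] := @uniformly_bounded_mixed f g; last by exists M.
by move=> h; apply/cvg_ex; exists h; exact: gf.
Qed.

Lemma pseudo_duals_of_finite_excess_frame g f : is_frame ip g ->
  finite_dimensional (synthesis_ker g) ->
  (s_pseudo_dual ip g f <-> a_pseudo_dual ip g f) /\
  (a_pseudo_dual ip g f <-> dual_frame ip g f).
Proof.
move=> /is_frameP[A [B gAB]] ker_fin; have [_ B_gt0 gB _] := gAB.
have f_bessel := pseudo_dual_bessel gAB ker_fin.
have s_to_a : s_pseudo_dual ip g f -> a_pseudo_dual ip g f.
  move=> gf; have [B' B'_gt0 fB'] := f_bessel f (or_introl gf).
  exact: s_pseudo_dual_sym gB fB' gf.
have a_to_s : a_pseudo_dual ip g f -> s_pseudo_dual ip g f.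
  move=> gf; have [B' B'_gt0 fB'] := f_bessel f (or_intror gf).
  exact: s_pseudo_dual_sym fB' gB gf.
split; first by split.
split=> [gf|[]//].
have [B' B'_gt0 fB'] := f_bessel f (or_intror gf).
split; [|exact: a_to_s|exact: gf].
by apply/is_frameP; exists B^-1, B'; exact: dual_frame_bounds (a_to_s gf).
Qed.

End Hilbert.

Unset Implicit Arguments.

Theorem proposition5p11 (R : realType) (k : scalar_kind)
    (H : completeNormedModType (hscalar R k))
    (ip : {dot H for @hscalar_conj R k})
    (ip_norm : forall x : H, `|x| ^+ 2 = ip x x)
    (H_separable : separable H)
    (H_infinite_dim : ~ finite_dimensional [set: H])
    (g : nat -> H) (g_frame : is_frame ip g)
    (ker_finite_dim : finite_dimensional (synthesis_ker g))
    (f : nat -> H) :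
  (s_pseudo_dual ip g f <-> a_pseudo_dual ip g f) /\
  (a_pseudo_dual ip g f <-> dual_frame ip g f).
Proof.
exact: (pseudo_duals_of_finite_excess_frame (hscalar_real_scaled R k) ip_norm).
Qed.
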